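(* Let $\ell\ge 101$ be an integer and let $r=r(d)\in\mathbb{N}$ satisfy $r=o(d^{50}/\log^{50}d)$ as $d\to\infty$. Let $c_1>0$ be a constant and, for each $d$ for which it exists, let $\Psi$ be a packing set with constant $c_1$ for $(d,r)$, as defined in the context (for a suitable $c_1$ not depending on $d,r$, such a set exists for all sufficiently large $d,r$). Then for every $\delta\in(0,1)$ there exist a constant $c>0$ (not depending on $d,r,B,N$) and thresholds $d_0,r_0,B_0$ such that the following holds for all $d\ge d_0$ with $r=r(d)\ge r_0$ and all $B\ge B_0$ ($B$ may depend on $d,r$). Let $\boldsymbol{\mathcal{T}}^*$ be drawn uniformly from $\Psi$, and let $\boldsymbol{X}_1,\dots,\boldsymbol{X}_N$ be i.i.d. random vectors in $\mathbb{R}^d$ such that, for each $i$, the entries $\boldsymbol{X}_i(j)$, $j\in\{1,\dots,d\}$, are i.i.d. samples from an arbitrary distribution on $[-B,B]\cap\mathbb{Z}$; suppose $\boldsymbol{\mathcal{T}}^*$ is independent of $(\boldsymbol{X}_i)_{i\le N}$. Let $Y_i=\langle\boldsymbol{\mathcal{T}}^*,\boldsymbol{X}_i^{\otimes\ell}\rangle$, $i=1,\dots,N$. If $$N\le \frac{c\,d\,r^{0.98}}{\log r+\ell\log(Bd)},$$ then $$\inf_{\widehat{\boldsymbol{\mathcal{T}}}}\ \mathbb{P}\bigl[\widehat{\boldsymbol{\mathcal{T}}}\ne\boldsymbol{\mathcal{T}}^*\bigr]\ge\delta,$$ where the infimum is over all (deterministic or randomized) estimators $\widehat{\boldsymbol{\mathcal{T}}}$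 of $\boldsymbol{\mathcal{T}}^*$ based on the data $(Y_i,\boldsymbol{X}_i)$, $i=1,\dots,N$.
   Context: An order-$\ell$ tensor $\boldsymbol{\mathcal{T}}\in\mathbb{R}^{d\times\cdots\times d}$ is an array of real numbers indexed by $\{1,\dots,d\}^\ell$; $\langle\cdot,\cdot\rangle$ is the Euclidean inner product on $\mathbb{R}^{d^\ell}$ and $\|\boldsymbol{\mathcal{T}}\|_F=\sqrt{\langle\boldsymbol{\mathcal{T}},\boldsymbol{\mathcal{T}}\rangle}$. For $\boldsymbol{v}\in\mathbb{R}^d$, $(\boldsymbol{v}^{\otimes \ell})_{i_1,\dots,i_\ell}=\boldsymbol{v}(i_1)\cdots\boldsymbol{v}(i_\ell)$. The symmetric rank is $\mathrm{rank}_S(\boldsymbol{\mathcal{T}})=\min\{s\ge1:\boldsymbol{\mathcal{T}}=\sum_{i\le s}\lambda_i\boldsymbol{v}_i^{\otimes\ell},\ \lambda_i\in\mathbb{R},\ \boldsymbol{v}_i\in\mathbb{R}^d\}$ (and $+\infty$ if no such decomposition exists). Packing set with constant $c_1$ for $(d,r)$: a set $\Psi\subset\{\boldsymbol{\mathcal{T}}\in\mathbb{R}^{d\times\cdots\times d}:\mathrm{rank}_S(\boldsymbol{\mathcal{T}})\le r\}$ of order-$\ell$ tensors such that (i) $|\Psi|\ge e^{c_1dr^{0.98}}$; (ii) $\|\boldsymbol{\mathcal{T}}-\boldsymbol{\mathcal{T}}'\|_F\ge1$ for all distinct $\boldsymbol{\mathcal{T}},\boldsymbol{\mathcal{T}}'\in\Psi$;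 (iii) for every $\boldsymbol{\mathcal{T}}\in\Psi$, $\|\boldsymbol{\mathcal{T}}\|_F\le r$ and $d^{\ell/2}\boldsymbol{\mathcal{T}}$ has integer entries. (Such a set is automatically finite.) An estimator is a (possibly randomized) measurable function of the data, with any additional randomness independent of $\boldsymbol{\mathcal{T}}^*$ and the data. *)

(* Defs.v *)
From HB Require Import structures.
From mathcomp Require Import all_boot all_order all_algebra.
From mathcomp Require Import finmap.
From mathcomp Require Import all_classical all_reals all_analysis.

Set Implicit Arguments.
Unset Strict Implicit.
Unset Printing Implicit Defensive.

Import Order.TTheory GRing.Theory Num.Theory.
Import numFieldNormedType.Exports.

Local Open Scope classical_set_scope.
Local Open Scope ring_scope.

(* Vectors of R^d are [d.-tuple R], the model of R^d that the library equips
   with the Borel (product) sigma-algebra. *)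

Definition multi_index (l d : nat) : finType := {ffun 'I_l -> 'I_d}.

Definition tensor (R : realType) (l d : nat) : Type :=
  {ffun multi_index l d -> R}.
HB.instance Definition _ (R : realType) (l d : nat) :=
  GRing.Zmodule.on (tensor R l d).
HB.instance Definition _ (R : realType) (l d : nat) :=
  isPointed.Build (tensor R l d) 0.

Definition entry (R : realType) (l d : nat) (T : tensor R l d)
  (i : multi_index l d) : R := (T : {ffun multi_index l d -> R}) i.

(* The sets {T | T i \in A}, A Borel, generate the Borel sigma-algebra of
   R^(d^l). *)
Definition tensor_cylinders (R : realType) (l d : nat) :
    set (set (tensor R l d)) :=
  [set C | exists (i : multi_index l d) (A : set R),
     measurable A /\ C = [set T | A (entry T i)]].

HB.instance Definition _ (R : realType) (l d : nat) :=
  Measurable.copy (tensor R l d)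
    (g_sigma_algebraType (@tensor_cylinders R l d)).

Section Tensors.
Context {R : realType} {l d : nat}.
Implicit Types (T : tensor R l d) (v : d.-tuple R).

Definition inner T T' : R := \sum_i entry T i * entry T' i.

Definition frobenius T : R := Num.sqrt (inner T T).

Definition tpower v : tensor R l d :=
  [ffun i : multi_index l d => \prod_(k < l) tnth v (i k)].

Definition sym_decomposable T (s : nat) : Prop :=
  exists (lam : 'I_s -> R) (v : 'I_s -> d.-tuple R),
    forall i, entry T i = \sum_(k < s) lam k * entry (tpower (v k)) i.

(* [+oo] when there is no decomposition, the infimum of [set0] being [+oo]. *)
Definition symrank T : \bar R :=
  ereal_inf [set (s%:R)%:E | s in [set s | (1 <= s)%N /\ sym_decomposable T s]].

Record is_packing (c1 : R) (r : nat) (Psi : {fset tensor R l d}) : Prop := {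
  packing_rank : forall T, T \in Psi -> (symrank T <= (r%:R)%:E)%E ;
  packing_card :
    expR (c1 * d%:R * (r%:R `^ (98 / 100))) <= #|` Psi|%:R ;
  packing_sep : forall T T', T \in Psi -> T' \in Psi -> T != T' ->
    1 <= frobenius (T - T') ;
  packing_norm : forall T, T \in Psi -> frobenius T <= r%:R ;
  packing_int : forall T, T \in Psi ->
    forall i, d%:R `^ (l%:R / 2) * entry T i \is a Num.int
}.

End Tensors.

Section Independence.
Context {R : realType} {d0 : measure_display} {Omega : measurableType d0}.
Variable P : probability Omega R.

Definition mutually_independent (I : finType) {d1 : measure_display}
    {E : measurableType d1} (X : I -> Omega -> E) : Prop :=
  forall (J : {set I}) (A : I -> set E), (forall i, measurable (A i)) ->
    P (\bigcap_(i in [set i | i \in J]) (X i @^-1` A i)) =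
    (\prod_(i in J) P (X i @^-1` A i))%E.

Definition independent {d1 d2 : measure_display}
    {E1 : measurableType d1} {E2 : measurableType d2}
    (X : Omega -> E1) (Y : Omega -> E2) : Prop :=
  forall (A : set E1) (B : set E2), measurable A -> measurable B ->
    P ((X @^-1` A) `&` (Y @^-1` B)) = (P (X @^-1` A) * P (Y @^-1` B))%E.

Definition has_law {d1 : measure_display} {E : measurableType d1}
    (X : Omega -> E) (mu : probability E R) : Prop :=
  forall A : set E, measurable A -> P (X @^-1` A) = mu A.

End Independence.

Section Model.
Context {R : realType} {l d N : nat}.
Context {d0 : measure_display} {Omega : measurableType d0}.
Variable P : probability Omega R.
Variable Tstar : {RV P >-> tensor R l d}.

Definition drawn_uniformly (Psi : {fset tensor R l d}) : Prop :=
  forall T, T \in Psi -> P (Tstar @^-1` [set T]) = ((#|` Psi|%:R)^-1)%:E.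

Definition supported_on_integers (B : R) (mu : probability R R) : Prop :=
  mu [set x | x \is a Num.int /\ - B <= x <= B] = 1%E.

Variable X : 'I_N -> {RV P >-> d.-tuple R}.

Definition iid_integer_design (B : R) : Prop :=
  exists mu : probability R R,
    [/\ supported_on_integers B mu,
        mutually_independent P (fun i w => X i w),
        forall i, mutually_independent P (fun (j : 'I_d) w => tnth (X i w) j)
      & forall i (j : 'I_d), has_law P (fun w => tnth (X i w) j) mu].

Definition design (w : Omega) : N.-tuple (d.-tuple R) := [tuple X i w | i < N].

Definition response (i : 'I_N) (w : Omega) : R :=
  inner (Tstar w) (tpower (X i w)).

Definition data (w : Omega) : N.-tuple (R * d.-tuple R) :=
  [tuple (response i w, X i w) | i < N].

(* A randomized estimator is a measurable function of the data and of a random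
   seed u with values in an arbitrary probability space (U, Q); the experiment
   runs on the product space [P \x Q], which makes the seed independent of
   (Tstar, X).  Deterministic estimators are those ignoring the seed. *)
Definition error_probabilities : set (\bar R) :=
  [set p | exists (d1 : measure_display) (U : measurableType d1)
     (Q : probability U R)
     (That : {mfun (N.-tuple (R * d.-tuple R) * U)%type >-> tensor R l d}),
     p = (P \x Q)%E [set w | That (data w.1, w.2) <> Tstar w.1]].

End Model.

(* Main.v *)
(* Fix the seed and an integer design x with entries in [-B, B].  For T in the
   packing, the numbers d^(l/2) Y_i are integers of modulus at most
   d^(2l) r B^l, so the responses take at most exp (3 N (log r + l log (B d)))
   values; an estimator thus recovers at most that many T from x.  As T^* is
   uniform and independent of the design, averaging over x bounds the success
   probability by this number divided by |Psi|, hence by exp (- c1 d r^0.98 / 2)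
   when c = c1 / 6, and the bound survives integration over the seed. *)
Require Import Defs.
From mathcomp Require Import all_boot all_order all_algebra.
From mathcomp Require Import finmap.
From mathcomp Require Import all_classical all_reals all_analysis.
From mathcomp Require Import measurable_realfun ring lra zify.

Set Implicit Arguments.
Unset Strict Implicit.

Import Order.TTheory GRing.Theory Num.Theory.
Import numFieldNormedType.Exports.

Local Open Scope classical_set_scope.
Local Open Scope ring_scope.

(** * Measurability of tensors and of the observation map *)

Lemma measurable_entry (R : realType) (l d : nat) (i : multi_index l d) :
  measurable_fun [set: tensor R l d] (fun T => entry T i).
Proof.
move=> _ A mA; rewrite setTI; apply: sub_sigma_algebra.
by exists i, A.
Qed.

Lemma tensor_eqP (R : realType) (l d : nat) (T T' : tensor R l d) :
  (forall i, entry T i = entry T' i) <-> T = T'.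
Proof. by split=> [h|->//]; apply/ffunP => i; exact: h. Qed.

(** Equality of tensors amounts to finitely many real equations, one for each multi-index. This
    makes success and error events measurable. *)
Lemma measurable_eq_tensor (R : realType) (l d : nat) (disp : measure_display)
    (Omega : measurableType disp) (f g : Omega -> tensor R l d) :
  measurable_fun [set: Omega] f -> measurable_fun [set: Omega] g ->
  measurable [set w | f w = g w].
Proof.
move=> mf mg.
have -> : [set w | f w = g w] = \bigcap_(i in [set: multi_index l d])
    ((fun w => entry (f w) i - entry (g w) i) @^-1` [set 0]).
  apply/seteqP; split=> w /= => [fg i _ /=|fg]; first by rewrite fg subrr.
  by apply/tensor_eqP => i; apply/eqP; rewrite -subr_eq0; apply/eqP/fg.
apply: fin_bigcap_measurable => // i _.
rewrite -[X in measurable X]setTI.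
have: measurable_fun [set: Omega] (fun w => entry (f w) i - entry (g w) i).
  apply: measurable_funB.
  - exact: (measurableT_comp (measurable_entry i) mf).
  - exact: (measurableT_comp (measurable_entry i) mg).
by apply.
Qed.

Lemma measurable_tensor1 (R : realType) (l d : nat) (T : tensor R l d) :
  measurable [set T].
Proof. exact: (@measurable_eq_tensor R l d _ _ id (cst T)). Qed.

(** The data as a deterministic function of a tensor and a design: once [T] is fixed, only the
    design is random, which is what independence from [Tstar] acts on. *)
Definition observe (R : realType) (l d N : nat) (T : tensor R l d)
    (x : N.-tuple (d.-tuple R)) : N.-tuple (R * d.-tuple R) :=
  [tuple (inner T (tpower (tnth x i)), tnth x i) | i < N].

Lemma measurable_inner_tpower (R : realType) (l d : nat)
    (disp : measure_display) (Omega : measurableType disp)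
    (T : Omega -> tensor R l d) (v : Omega -> d.-tuple R) :
  measurable_fun [set: Omega] T -> measurable_fun [set: Omega] v ->
  measurable_fun [set: Omega] (fun w => inner (T w) (tpower (v w))).
Proof.
move=> mT mv; apply: measurable_sum => i; apply: measurable_funM.
  exact: (measurableT_comp (measurable_entry i) mT).
under eq_fun => w do rewrite /entry ffunE.
apply: measurable_prod => k _.
exact: (measurableT_comp (measurable_tnth (i k)) mv).
Qed.

Lemma measurable_observe (R : realType) (l d N : nat)
    (disp : measure_display) (Omega : measurableType disp)
    (T : Omega -> tensor R l d) (x : Omega -> N.-tuple (d.-tuple R)) :
  measurable_fun [set: Omega] T -> measurable_fun [set: Omega] x ->
  measurable_fun [set: Omega] (fun w => observe (T w) (x w)).
Proof.
move=> mT mx; apply/measurable_fun_tnthP => i.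
have mxi : measurable_fun [set: Omega] (fun w => tnth (x w) i).
  exact: (measurableT_comp (measurable_tnth i) mx).
apply: (eq_measurable_fun
    (fun w => (inner (T w) (tpower (tnth (x w) i)), tnth (x w) i))).
  by move=> w _; rewrite /= tnth_mktuple.
exact: (measurable_fun_pair (measurable_inner_tpower mT mxi) mxi).
Qed.

Lemma measurable_set_int (R : realType) : measurable [set x : R | x \is a Num.int].
Proof.
apply: countable_measurable => //.
have -> : [set x : R | x \is a Num.int] = range (fun z : int => z%:~R).
  apply/seteqP; split=> x /= => [/intrP[z ->]|[z _ <-]]; first by exists z.
  exact: intr_int.
exact: card_le_trans (card_image_le _ _) (countableP _).
Qed.

(** * Sums of probabilities of overlapping events *)

(** The sum is the expectation of the number of events that occur, and this number never exceeds
    [K]. *)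
Lemma sum_probability_le (R : realType) (disp : measure_display)
    (Omega : measurableType disp) (P : probability Omega R) (I : Type)
    (s : seq I) (A : I -> set Omega) (K : nat) :
  (forall i, measurable (A i)) ->
  (forall w, (count (fun i => w \in A i) s <= K)%N) ->
  (\sum_(i <- s) P (A i) <= K%:R%:E)%E.
Proof.
move=> mA hK.
under eq_bigr => i _ do rewrite -(setIT (A i)) -integral_indic//.
rewrite -ge0_integral_sum//;
  last by move=> i; apply/measurable_EFinP; exact: measurable_indic.
apply: (@le_trans _ _ (\int[P]_(w in setT) (K%:R : R)%:E)%E).
  apply: ge0_le_integral => //.
  - by move=> w _; apply: sume_ge0 => i _; rewrite lee_fin.
  - apply: emeasurable_sum => i.
    by apply/measurable_EFinP; exact: measurable_indic.
  - move=> w _; rewrite sumEFin lee_fin.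
    under eq_bigr => i _ do rewrite indicE.
    rewrite -natr_sum ler_nat; apply: leq_trans (hK w).
    by rewrite -sum1_count [leqRHS]big_mkcond leq_sum// => i _; case: (_ \in _).
by rewrite integral_cst//= [X in (_ * X)%E]probability_setT mule1.
Qed.

Lemma probability_setIl (R : realType) (disp : measure_display)
    (Omega : measurableType disp) (P : probability Omega R) (D A : set Omega) :
  measurable D -> P D = 1%E -> measurable A -> P (D `&` A) = P A.
Proof.
move=> mD PD mA; rewrite (measureDI P mA mD) setIC [X in (X + _)%E](_ : _ = 0%E).
  by rewrite add0e.
apply: (@subset_measure0 _ _ _ P _ (~` D)).
- exact: measurableD.
- exact: measurableC.
- by move=> w [].
- by have := probability_setC P mD; rewrite PD subee.
Qed.

(** Intersecting every event with [D] keeps its probability and makes the count vanish outside [D],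
    so the pointwise bound holds everywhere. *)
Lemma sum_probability_le_ae (R : realType) (disp : measure_display)
    (Omega : measurableType disp) (P : probability Omega R) (I : Type)
    (s : seq I) (D : set Omega) (A : I -> set Omega) (K : nat) :
  measurable D -> P D = 1%E -> (forall i, measurable (A i)) ->
  (forall w, D w -> (count (fun i => w \in A i) s <= K)%N) ->
  (\sum_(i <- s) P (A i) <= K%:R%:E)%E.
Proof.
move=> mD PD mA hK.
under eq_bigr => i _ do rewrite -(probability_setIl mD PD (mA i)).
apply: sum_probability_le => [i|w]; first exact: measurableI.
have [Dw|nDw] := pselect (D w).
  rewrite (leq_trans _ (hK w Dw))//; apply: sub_count => i /=.
  by rewrite in_setI => /andP[].
rewrite (eq_count (a2 := pred0)) ?count_pred0// => i /=.
by rewrite in_setI memNset.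
Qed.

(** * Error probability of a deterministic estimator *)

Section deterministic.
Context (R : realType) (l d N : nat) (disp : measure_display).
Context (Omega : measurableType disp) (P : probability Omega R).
Context (Tstar : {RV P >-> tensor R l d}) (X : 'I_N -> {RV P >-> d.-tuple R}).

Lemma data_observe w : data Tstar X w = observe (Tstar w) (design X w).
Proof. by apply: eq_from_tnth => i; rewrite !tnth_mktuple. Qed.

Lemma measurable_design : measurable_fun [set: Omega] (design X).
Proof.
apply/measurable_fun_tnthP => i.
apply: (eq_measurable_fun (fun w => X i w)) => [w _|].
  by rewrite /= tnth_mktuple.
exact: measurable_funPT.
Qed.

Lemma measurable_data : measurable_fun [set: Omega] (data Tstar X).
Proof.
apply: (eq_measurable_fun (fun w => observe (Tstar w) (design X w))).
  by move=> w _; rewrite data_observe.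
by apply: measurable_observe; [exact: measurable_funPT|exact: measurable_design].
Qed.

(** With [T] fixed, recovery of [T] depends on the design alone. By independence, drawing [T] and
    missing it has probability [(1 - P (C T)) / #|Psi|], where [C T] says that the design lets [f]
    recover [T]. At most [K] of the events [C T] occur together, so their probabilities sum to at
    most [K]. *)
Lemma error_probability_ge (Psi : {fset tensor R l d})
    (f : N.-tuple (R * d.-tuple R) -> tensor R l d)
    (D : set Omega) (K : nat) :
  drawn_uniformly Tstar Psi -> independent P Tstar (design X) ->
  measurable_fun [set: _] f -> (0 < #|` Psi|)%N ->
  measurable D -> P D = 1%E ->
  (forall w, D w ->
    (count (fun T => f (observe T (design X w)) == T) Psi <= K)%N) ->
  ((1 - K%:R / #|` Psi|%:R)%:E <=
     P [set w | f (data Tstar X w) <> Tstar w])%E.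
Proof.
move=> unif indep mf Psi0 mD PD hK.
have mB T : measurable [set x | f (observe T x) = T].
  have := @measurable_eq_tensor R l d _ _ (fun x => f (observe T x)) (cst T).
  by apply=> //; apply: (measurableT_comp mf); exact: measurable_observe.
pose C T := design X @^-1` [set x | f (observe T x) = T].
have mC T : measurable (C T).
  by rewrite /C -[X in measurable X]setTI; exact: measurable_design.
pose F T := Tstar @^-1` [set T] `&` design X @^-1` (~` [set x | f (observe T x) = T]).
have mF T : measurable (F T).
  apply: measurableI.
    by rewrite -[X in measurable X]setTI; apply: measurable_funPT => //;
      exact: measurable_tensor1.
  by rewrite -[X in measurable X]setTI; apply: measurable_design => //;
    exact: measurableC.
have sumPC : (\sum_(T <- Psi) P (C T) <= K%:R%:E)%E.
  apply: (sum_probability_le_ae mD PD mC) => w /hK; apply: leq_trans.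
  by apply: sub_count => T /=; rewrite inE => /eqP.
have PF T : T \in Psi -> P (F T) = ((#|` Psi|%:R)^-1 * (1 - fine (P (C T))))%:E.
  move=> TPsi; rewrite indep//; [|exact: measurable_tensor1|exact: measurableC].
  rewrite unif// -preimage_setC probability_setC; last exact: mC.
  by rewrite EFinM EFinB fineK// fin_num_measure.
(* The disjoint events [F T], T in Psi, are contained in the error event, so
   superadditivity suffices and Tstar need not be shown to lie in Psi a.s. *)
apply: (@le_trans _ _ (P (\big[setU/set0]_(T <- Psi) F T))); last first.
  apply: le_measure; rewrite ?inE.
  - by apply: bigsetU_measurable.
  - rewrite -[X in measurable X]setCK; apply: measurableC.
    have -> : ~` [set w | f (data Tstar X w) <> Tstar w] =
              [set w | f (data Tstar X w) = Tstar w].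
      by apply/seteqP; split=> w /= => [/contrapT|? ?].
    apply: measurable_eq_tensor; last exact: measurable_funPT.
    exact: (measurableT_comp mf measurable_data).
  - rewrite -bigcup_seq => w [T _ [/= TE nB]] fdata.
    by apply: nB; rewrite -TE -data_observe.
rewrite measure_fbigsetU//; last first.
  by apply/trivIsetP => T T' _ _ /eqP TT'; rewrite -subset0 => w [[/= + _] [/= + _]];
    move=> -> /TT'.
rewrite big_seq (eq_bigr _ PF) -big_seq sumEFin lee_fin -mulr_sumr sumrB.
rewrite big_const_seq count_predT iter_addr addr0.
have -> : size Psi = #|` Psi| by [].
rewrite mulrBr mulVf ?pnatr_eq0 -?lt0n// lerD2l lerN2.
rewrite mulrC ler_pM2r ?invr_gt0 ?ltr0n// -lee_fin -sumEFin.
under eq_bigr => T _ do rewrite fineK ?fin_num_measure//.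
exact: sumPC.
Qed.

End deterministic.

(** * Reduction of randomized estimators to deterministic ones *)

(** Freezing the seed at any value [u] leaves a deterministic estimator, so every section of the
    error event has probability at least [e]; integrating over the seed preserves the bound. *)
Lemma le_inf_error_probabilities (R : realType) (l d N : nat)
    (disp : measure_display) (Omega : measurableType disp)
    (P : probability Omega R) (Tstar : {RV P >-> tensor R l d})
    (X : 'I_N -> {RV P >-> d.-tuple R}) (e : R) :
  0 <= e ->
  (forall f : N.-tuple (R * d.-tuple R) -> tensor R l d,
    measurable_fun [set: _] f ->
    (e%:E <= P [set w | f (data Tstar X w) <> Tstar w])%E) ->
  (e%:E <= ereal_inf (error_probabilities Tstar X))%E.
Proof.
move=> e0 he; apply: le_ereal_inf_tmp => _ [d1 [U [Q [That ->]]]].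
set E := [set w | _].
have mT : measurable_fun [set: Omega * U] (fun w => Tstar w.1).
  exact: measurableT_comp.
have mE : measurable E.
  rewrite -[X in measurable X]setCK; apply: measurableC.
  have -> : ~` E = [set w | That (data Tstar X w.1, w.2) = Tstar w.1].
    by apply/seteqP; split=> w /= => [/contrapT|? ?].
  apply: measurable_eq_tensor => //.
  apply: measurableT_comp; first exact: measurable_funPT.
  apply: measurable_fun_pair => //.
  exact: (measurableT_comp (measurable_data Tstar X)).
(* Uniqueness of the product measure exchanges the order of integration, so that the seed becomes
   the outer variable. *)
have -> : ((P \x Q) E = (P \x^ Q) E)%E.
  by apply: product_measure_unique => // A B mA mB; exact: product_measure2E.
rewrite -[leLHS]mule1 -(probability_setT Q) -integral_cst//.
apply: ge0_le_integral => //.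
- exact: measurable_fun_ysection.
- move=> u _ /=.
  have := he (fun D => That (D, u)); rewrite ysectionE; apply.
  by apply: measurable_fun_pair1; exact: measurable_funPT.
Qed.

(** * Counting the tensors recovered from a fixed design *)

Lemma leq_count_inj (T : eqType) (F : finType) (s : seq T) (p : pred T)
    (code : T -> F) :
  uniq s -> {in [pred x in s | p x] &, injective code} ->
  (count p s <= #|F|)%N.
Proof.
move=> us injc; rewrite -size_filter -(size_map code).
rewrite -(card_uniqP _) ?max_card// map_inj_in_uniq ?filter_uniq//.
by move=> x y; rewrite !mem_filter => /andP[px xs] /andP[py ys]; apply: injc;
  rewrite inE ?xs ?ys.
Qed.

(** A recovered tensor is the output of [f] on its own observation, hence is determined by its [N]
    responses. Scaled by [a], each response is an integer in [[-m, m]], with [m] the integer part of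
    [y], which leaves [2 m + 1] values. *)
Lemma count_recovered (R : realType) (l d N : nat) (Psi : {fset tensor R l d})
    (x : N.-tuple (d.-tuple R))
    (f : N.-tuple (R * d.-tuple R) -> tensor R l d) (a y : R) :
  a != 0 ->
  (forall T i, T \in Psi ->
    a * inner T (tpower (tnth x i)) \is a Num.int /\
    `|a * inner T (tpower (tnth x i))| <= y) ->
  (count (fun T => f (observe T x) == T) Psi <= (2 * Num.truncn y).+1 ^ N)%N.
Proof.
move=> a0 hPsi; set m := Num.truncn y.
pose z (T : tensor R l d) i := Num.floor (a * inner T (tpower (tnth x i))).
(* The shift by [m] sends [[-m, m]] onto [[0, 2 m]], where neither [absz] nor the default value of
   [inord] identifies distinct integers. *)
pose code T : {ffun 'I_N -> 'I_(2 * m).+1} :=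
  [ffun i => inord (absz (z T i + m%:Z))].
have zE T i : T \in Psi -> (z T i)%:~R = a * inner T (tpower (tnth x i)).
  by move=> /(hPsi T i)[h _]; rewrite /z floorK.
have zm T i : T \in Psi -> (`|z T i| <= m%:Z)%R.
  move=> TPsi; rewrite -abszE lez_nat truncn_ge_nat.
    by rewrite natr_absz intr_norm zE//; apply: (hPsi T i TPsi).2.
  exact: le_trans (normr_ge0 _) (hPsi T i TPsi).2.
rewrite -[X in (_ <= X)%N](_ : #|{ffun 'I_N -> 'I_(2 * m).+1}| = _); last first.
  by rewrite card_ffun !card_ord.
apply: (leq_count_inj (code := code) (fset_uniq Psi)) => T T'; rewrite !inE.
move=> /andP[TPsi /eqP fT] /andP[T'Psi /eqP fT'] /ffunP eqc.
(* Both observations carry the same design, so only the responses have to be compared. *)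
rewrite -fT -fT'; congr f; apply: eq_from_tnth => i; rewrite !tnth_mktuple.
congr pair; apply: (mulfI a0); rewrite -!zE//; congr (_%:~R).
have := congr1 (@nat_of_ord _) (eqc i); rewrite !ffunE.
have := zm T i TPsi; have := zm T' i T'Psi.
by move=> h h'; rewrite !inordK; lia.
Qed.

(** * Size and integrality of the scaled responses *)

Lemma entry_le_frobenius (R : realType) (l d : nat) (T : tensor R l d)
    (i : multi_index l d) : `|entry T i| <= frobenius T.
Proof.
rewrite /frobenius -sqrtr_sqr ler_wsqrtr// /inner (bigD1 i)//= expr2 lerDl.
by apply: sumr_ge0 => j _; rewrite -expr2 sqr_ge0.
Qed.

Lemma norm_inner_tpower_le (R : realType) (l d : nat) (T : tensor R l d)
    (v : d.-tuple R) (B rho : R) :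
  frobenius T <= rho -> (forall j, `|tnth v j| <= B) ->
  `|inner T (tpower v)| <= (d ^ l)%:R * (rho * B ^+ l).
Proof.
move=> Trho vB; apply: (le_trans (ler_norm_sum _ _ _)).
apply: (@le_trans _ _ (\sum_(i : multi_index l d) rho * B ^+ l)).
  apply: ler_sum => i _; rewrite normrM ler_pM//.
    exact: le_trans (entry_le_frobenius T i) Trho.
  rewrite /entry ffunE normr_prod -[X in B ^+ X](card_ord l) -prodr_const.
  by apply: ler_prod => k _; rewrite normr_ge0 vB.
by rewrite sumr_const card_ffun !card_ord mulr_natl.
Qed.

Lemma int_inner_tpower (R : realType) (l d : nat) (T : tensor R l d)
    (v : d.-tuple R) (a : R) :
  (forall i, a * entry T i \is a Num.int) ->
  (forall j, tnth v j \is a Num.int) ->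
  a * inner T (tpower v) \is a Num.int.
Proof.
move=> Tint vint; rewrite /inner mulr_sumr rpred_sum// => i _.
by rewrite mulrA rpredM// /entry ffunE rpred_prod.
Qed.

(** * Numerical estimates *)

Lemma powR_half_le (R : realType) (l d : nat) :
  (0 < d)%N -> (d%:R : R) `^ (l%:R / 2) <= (d ^ l)%:R.
Proof.
move=> d0; rewrite natrX -powR_mulrn// ler_powR ?ler1n//.
by rewrite ler_pdivrMr// ler_peMr ?ler0n// ler1n.
Qed.

(** With [q = d ^ l] and [b = B ^+ l], the right side is [(rho b q)^3], while the left is at most
    three times [y = q^2 rho b]. After cancelling [rho b q^2] it remains that [3 <= rho^2 b^2 q],
    which follows from [3 <= q]. *)
Lemma quantization_le (R : realType) (l d : nat) (B rho : R) :
  (0 < l)%N -> (3 <= d)%N -> 1 <= B -> 1 <= rho ->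
  (2 * Num.truncn ((d ^ l)%:R * ((d ^ l)%:R * (rho * B ^+ l)))).+1%:R <=
  expR (3 * (ln rho + l%:R * ln (B * d%:R))).
Proof.
move=> l0 d3 B1 rho1.
set q : R := (d ^ l)%:R; set b := B ^+ l.
have q3 : 3 <= q by rewrite ler_nat (leq_trans d3)// -[leqLHS]expn1 leq_exp2l//; lia.
have b1 : 1 <= b by rewrite exprn_ege1.
set y := q * _.
have y1 : 1 <= y.
  by rewrite /y; do 2!(rewrite mulr_ege1 ?(le_trans _ q3) ?ler1n//); rewrite mulr_ege1.
have d0 : 0 < B * d%:R by rewrite mulr_gt0 ?ltr0n ?(lt_le_trans ltr01 B1)//; lia.
have -> : expR (3 * (ln rho + l%:R * ln (B * d%:R))) = (rho * (b * q)) ^+ 3.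
  rewrite expRM_natl expRD lnK ?posrE ?(lt_le_trans ltr01)//.
  by rewrite expRM_natl lnK ?posrE// [(B * _) ^+ l]exprMn /q natrX.
have tr : (Num.truncn y)%:R <= y by rewrite Num.Theory.truncn_le; lra.
(* The successor is absorbed by [1 <= y]. *)
apply: (@le_trans _ _ (3 * y)); first by rewrite -addn1 natrD natrM; lra.
rewrite /y !exprMn.
have -> : 3 * (q * (q * (rho * b))) = (rho * b * q ^+ 2) * 3 by ring.
have -> : rho ^+ 3 * (b ^+ 3 * q ^+ 3) = (rho * b * q ^+ 2) * (rho ^+ 2 * (b ^+ 2 * q)).
  by ring.
rewrite ler_pM2l; last by rewrite !mulr_gt0 ?exprn_gt0 ?(lt_le_trans ltr01)//; lra.
apply: le_trans q3 _; rewrite mulrA; apply: ler_peMl; first exact: ler0n.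
by rewrite mulr_ege1 ?exprn_ege1.
Qed.

(** Here [s] stands for [r^0.98] and [L] for the denominator in the bound on [N]. Since [1 <= s], a
    lower bound on [d] alone makes [exp (- c1 d s / 2)] at most [1 - delta]. *)
Lemma packing_ratio_le (R : realType) (c1 s delta L : R) (d N K n : nat) :
  0 < c1 -> 1 <= s -> delta < 1 -> 0 < L ->
  2 / c1 * - ln (1 - delta) <= d%:R ->
  N%:R <= c1 / 6 * d%:R * s / L -> K%:R <= expR (3 * L) ->
  expR (c1 * d%:R * s) <= n%:R ->
  (K ^ N)%:R / n%:R <= 1 - delta.
Proof.
move=> c10 s1 delta1 L0 hd hN hK hn.
have n0 : 0 < n%:R :> R by rewrite (lt_le_trans _ hn)// expR_gt0.
(* The exponent [3 L N] is at most [3 (c1 / 6) d s], half of the exponent of the packing; the other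
   half pays for [1 - delta]. *)
rewrite ler_pdivrMr//; apply: (@le_trans _ _ (expR (c1 / 2 * d%:R * s))).
  apply: (@le_trans _ _ (expR (3 * L) ^+ N)).
    by rewrite natrX lerXn2r// nnegrE ?expR_ge0.
  rewrite -expRM_natl ler_expR.
  by move: hN; rewrite ler_pdivlMr//; lra.
apply: le_trans (ler_wpM2l _ hn); last by rewrite subr_ge0 ltW.
have dd : 0 < 1 - delta by rewrite subr_gt0.
rewrite -[X in _ <= X * _](@lnK _ (1 - delta)) ?posrE// -expRD ler_expR.
have : - ln (1 - delta) <= c1 / 2 * d%:R.
  move: hd; rewrite mulrAC ler_pdivrMr//; lra.
have : c1 / 2 * d%:R <= c1 / 2 * d%:R * s.
  by rewrite ler_peMr// mulr_ge0 ?ler0n// divr_ge0// ltW.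
lra.
Qed.

(** * Almost sure integrality and boundedness of the design *)

Lemma integer_design_event (R : realType) (d N : nat) (disp : measure_display)
    (Omega : measurableType disp) (P : probability Omega R)
    (X : 'I_N -> {RV P >-> d.-tuple R}) (B : R) :
  iid_integer_design X B ->
  exists D : set Omega, [/\ measurable D, P D = 1%E &
    forall w, D w -> forall i j,
      tnth (X i w) j \is a Num.int /\ `|tnth (X i w) j| <= B].
Proof.
move=> [mu [mu1 _ _ law]]; pose S : set R := [set x | x \is a Num.int /\ - B <= x <= B].
have mS : measurable S.
  rewrite (_ : S = [set x | x \is a Num.int] `&` `[- B, B]%classic).
    by apply: measurableI; [exact: measurable_set_int|exact: measurable_itv].
  by apply/seteqP; split=> x /=; rewrite in_itv.
pose D (p : 'I_N * 'I_d) := (fun w => tnth (X p.1 w) p.2) @^-1` S.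
exists (\big[setI/setT]_p D p).
have [mD PD] : measurable (\big[setI/setT]_p D p) /\
    P (\big[setI/setT]_p D p) = 1%E.
  (* There are finitely many coordinates, and each lies in [S] with probability one because its law
     is [mu]. *)
  elim/big_ind : _ => [|A1 A2 [mA1 PA1] [mA2 PA2]|p _].
  - by split; [exact: measurableT|exact: probability_setT].
  - by split; [exact: measurableI|rewrite probability_setIl].
  - split; last by rewrite law.
    rewrite -[X in measurable X]setTI.
    exact: (measurableT_comp (measurable_tnth p.2)).
split=> // w; rewrite -bigcap_seq => Dw i j.
have := Dw (i, j); rewrite /= mem_index_enum => /(_ isT)[-> h].
by split=> //; rewrite ler_norml.
Qed.

(** * The lower bound with explicit constant and thresholds *)

Unset Implicit Arguments.
Set Strict Implicit.

Theorem theorem2p5 (R : realType) (l : nat) (hl : (101 <= l)%N)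
  (c1 : R) (hc1 : 0 < c1) (delta : R) (hdelta : 0 < delta < 1) :
  exists2 c : R, 0 < c &
  forall (r : nat -> nat)
    (hr : (fun d : nat => (r d)%:R : R^o) =o_\oo
          (fun d : nat => d%:R ^+ 50 / ln d%:R ^+ 50 : R^o))
    (Psi : forall d : nat, {fset tensor R l d}),
  exists (d0 r0 : nat) (B0 : R),
  forall (d : nat) (hd : (d0 <= d)%N) (hrd : (r0 <= r d)%N)
    (hPsi : is_packing c1 (r d) (Psi d))
    (B : R) (hB : B0 <= B)
    (disp : measure_display) (Omega : measurableType disp)
    (P : probability Omega R) (N : nat)
    (Tstar : {RV P >-> tensor R l d})
    (X : 'I_N -> {RV P >-> d.-tuple R})
    (hTstar : drawn_uniformly Tstar (Psi d))
    (hX : iid_integer_design X B)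
    (hindep : independent P Tstar (design X))
    (hN : N%:R <= c * d%:R * ((r d)%:R `^ (98 / 100))
                  / (ln (r d)%:R + l%:R * ln (B * d%:R))),
  (delta%:E <= ereal_inf (error_probabilities Tstar X))%E.
Proof.
have /andP[delta0 delta1] := hdelta.
exists (c1 / 6) => [|r _ Psi]; first by rewrite divr_gt0.
(* The summand 3 gives [3 <= d ^ l] for the quantization bound, and the truncation puts [d] above
   the threshold of [packing_ratio_le]. The values 1 for [r0] and [B0] make [ln r] nonnegative and,
   as [d >= 3], [ln (B d)] positive. *)
exists (3 + Num.truncn (2 / c1 * - ln (1 - delta)))%N, 1%N, 1.
move=> d hd hrd hPsi B hB disp Omega P N Tstar X hTstar hX hindep hN.
have d3 : (3 <= d)%N by lia.
have rho1 : 1 <= (r d)%:R :> R by rewrite ler1n.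
apply: le_inf_error_probabilities => [|f mf]; first exact: ltW.
pose q : R := (d ^ l)%:R.
pose m := Num.truncn (q * (q * ((r d)%:R * B ^+ l))).
have card0 : (0 < #|` Psi d|)%N.
  by rewrite -(ltr0n R) (lt_le_trans _ (packing_card hPsi))// expR_gt0.
have [D [mD PD hD]] := integer_design_event hX.
apply: le_trans (error_probability_ge hTstar hindep mf card0 mD PD
  (K := ((2 * m).+1 ^ N)%N) _); last first.
  move=> w /hD Xw.
  (* The scale is the one that makes the entries of the packing integral; it is then bounded by
     [d ^ l], the outer factor [q] in [m]. *)
  apply: (@count_recovered _ _ _ _ _ _ _ (d%:R `^ (l%:R / 2))).
    by rewrite powR_eq0 pnatr_eq0; apply/nandP; left; lia.
  move=> T i TPsi; rewrite tnth_mktuple; split.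
    apply: int_inner_tpower => [j|j]; first exact: (packing_int hPsi).
    by have [] := Xw i j.
  rewrite normrM ler_pM//.
    by rewrite ger0_norm ?powR_ge0// powR_half_le//; lia.
  apply: norm_inner_tpower_le; first exact: (packing_norm hPsi).
  by move=> j; have [] := Xw i j.
have L0 : 0 < ln (r d)%:R + l%:R * ln (B * d%:R).
  rewrite ltr_wpDl ?ln_ge0// mulr_gt0 ?ltr0n//; first lia.
  rewrite ln_gt0// (@lt_le_trans _ _ d%:R) ?ltr1n//; first lia.
  by rewrite ler_peMl.
rewrite lee_fin lerBrDl -lerBrDr.
apply: (packing_ratio_le hc1 _ delta1 L0 _ hN _ (packing_card hPsi)).
(* Writing 1 as [r^0] gives [1 <= r^0.98] by monotonicity in the exponent, since [1 <= r]. *)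
- by rewrite -[leLHS](powRr0 (r d)%:R) ler_powR// divr_ge0.
- apply: ltW (lt_le_trans (truncnS_gt _) _).
  by rewrite ler_nat; apply: leq_trans hd; rewrite -add1n leq_add2r.
- by apply: quantization_le => //; lia.
Qed.
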